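(* Let $k$ be a field of characteristic zero, let $V$ be a finite dimensional $k$-vector space and let $\mathcal{N}$ be a non-zero abelian subspace of $\operatorname{End}(V)$ consisting of nilpotent operators. Then there exist a linearly independent set $B=\{v_1,\dots,v_s\}\subset V$ and a direct sum decomposition $\mathcal{N}=\mathcal{N}_1\oplus\dots\oplus\mathcal{N}_s$ into subspaces, with $\mathcal{N}_i\neq 0$ for all $i$, such that the maps $F_i:\mathcal{N}\to V$ defined by $F_i(N)=N(v_i)$ satisfy \begin{enumerate} \item[(1)] $F_i|_{\mathcal{N}_i}$ is injective for all $i=1,\dots,s$; \item[(2)] $\mathcal{N}_j\subset\ker F_i$ for all $1\le i<j\le s$; \item[(3)] $\mathcal{N}_jV\subset \operatorname{im} F_i|_{\mathcal{N}_i}$ for all $1\le i<j\le s$. \end{enumerate} Furthermore, given a finite subset $\{N_1,\dots,N_q\}$ of non-zero operators in $\mathcal{N}$, the vector $v_1$ can be chosen so that $N_k(v_1)\neq 0$ for all $k=1,\dots,q$ (that is, $B$ and the decomposition satisfying (1), (2), (3) can be chosen so that this also holds).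
   Context: An abelian subspace of $\operatorname{End}(V)$ is a $k$-linear subspace whose elements commute pairwise. For a subspace $\mathcal{M}\subset\operatorname{End}(V)$, $\mathcal{M}V$ denotes the span of $\{N(v): N\in\mathcal{M},\ v\in V\}$. *)

(* Defs.v *)
From HB Require Import structures.
From mathcomp Require Import all_boot all_order all_algebra.

Set Implicit Arguments.
Unset Strict Implicit.
Unset Printing Implicit Defensive.

Import GRing.Theory.
Local Open Scope ring_scope.

Section OperatorSpaces.

Variables (k : fieldType) (V : vectType k).
Implicit Types (f : 'End(V)) (v w : V) (M N : {vspace 'End(V)}).

(* 'End(V) carries a ring structure in the library only when V != 0, so powers
   are spelled out as iterated composition. *)
Definition nilpotent_op f : Prop :=
  exists n : nat, iter n (comp_lfun f) \1%VF = 0.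

Definition abelian_ops N : Prop :=
  forall f g : 'End(V), f \in N -> g \in N -> (f \o g)%VF = (g \o f)%VF.

(* MV. It is enough to sum the images of the operators of a basis of M;
   ops_imageP shows that this is the span of all the vectors f v with f in M. *)
Definition ops_image M : {vspace V} := (\sum_(f <- vbasis M) limg f)%VS.

Lemma mem_ops_image M f v : f \in M -> f v \in ops_image M.
Proof.
move=> /coord_vbasis ->; rewrite sum_lfunE; apply: memv_suml => i _.
rewrite scale_lfunE memvZ //; set g := _`_i.
have gB : g \in vbasis M by rewrite mem_nth // size_tuple.
by rewrite /ops_image (big_rem g) //= memvE -[X in (X <= _)%VS]addv0
  addvS ?sub0v // -memvE memv_img ?memvf.
Qed.

Lemma ops_imageP M w :
  w \in ops_image M <->
  exists2 X : seq V,
    forall x, x \in X -> exists f v, f \in M /\ x = f v & w \in <<X>>%VS.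
Proof.
split=> [wM | [X XM]]; last first.
  suff /subvP sXM : (<<X>> <= ops_image M)%VS by apply: sXM.
  by apply/span_subvP => x /XM[f [v [fM ->]]]; apply: mem_ops_image.
exists [seq (f : 'End(V)) v | f <- vbasis M, v <- vbasis {:V}].
  by move=> x /allpairsP[[f v] /= [/vbasis_mem fM _ ->]]; exists f, v.
move: w wM; apply/subvP; rewrite /ops_image.
elim: {M} (val (vbasis M)) => [|f s IHs]; first by rewrite big_nil sub0v.
by rewrite big_cons /= span_cat addvS // -limg_span (span_basis (vbasisP _)).
Qed.

(* N |-> N v; for v = v_i its restriction to the space of operators is F_i. *)
Definition eval_at v : 'Hom('End(V), V) := linfun (fun f : 'End(V) => f v).

Fact eval_at_is_linear v : linear (fun f : 'End(V) => f v).
Proof. by move=> a f g; rewrite add_lfunE scale_lfunE. Qed.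

Lemma eval_atE v f : eval_at v f = f v.
Proof.
pose L := GRing.isLinear.Build _ _ _ _ _ (eval_at_is_linear v).
pose F : {linear 'End(V) -> V} := HB.pack (fun f : 'End(V) => f v) L.
exact: (lfunE F f).
Qed.

Definition adapted_decomposition N (s : nat) (v : s.-tuple V)
    (N_ : 'I_s -> {vspace 'End(V)}) : Prop :=
  let F i := eval_at (tnth v i) in
  [/\ [/\ free v,
          N = (\sum_(i < s) N_ i)%VS,
          directv (\sum_(i < s) N_ i)
        & forall i, N_ i != 0%VS],
      forall i, {in N_ i &, injective (F i)},
      forall i j : 'I_s, (i < j)%N -> (N_ j <= N :&: lker (F i))%VS
    & forall i j : 'I_s, (i < j)%N -> (ops_image (N_ j) <= F i @: N_ i)%VS].

End OperatorSpaces.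

(* Main.v *)
Require Import Defs.
From HB Require Import structures.
From mathcomp Require Import all_boot all_order all_algebra.

(** Everything rests on the choice of the first vector. For [v] in [V] write
[F_v : N -> V] for the evaluation [f |-> f v], and [K_v] for its kernel in
[N]. If [v] maximizes the rank of [F_v], then every operator of [K_v] maps all
of [V] into [F_v(N)]. Indeed, otherwise some [f] in [K_v] and some [w] have
[f w] outside [F_v(N)]; pick [g_1, ..., g_r] in [N] such that the [g_i v] form
a basis of [F_v(N)]. The vectors [g_1 v, ..., g_r v, f w] are independent,
hence so are [g_1 (v + t w), ..., g_r (v + t w), f w] for all but finitely many
[t] ([generic_free]); since [f (v + t w) = t (f w)], the rank of
[F_(v + t w)] exceeds [r] as soon as also [t != 0] ([rank_increase]). Climbing
in this way from a vector that none of the prescribed operators kills, and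
choosing [t] so that they still do not kill [v + t w], one reaches a first
vector [v_1] that absorbs [N] in the sense of [absorbing]
([exists_absorbing]). Characteristic zero serves to provide infinitely many
scalars [t].

Take for [N_1] a complement of [K_(v_1)] in [N] and go on with [K_(v_1)], which
has smaller dimension. Condition (3) for [i = 1] follows because [v_1] is
absorbing, (1) and (2) for [i = 1] from the choice of [N_1] and the inclusion
of the later summands in [K_(v_1)], and all conditions for [i > 1] come from
the decomposition of [K_(v_1)] ([triangular_cons]). The independence of the
[v_i] is then automatic: each [N_j] kills the [v_i] with [i < j] but contains
an operator that does not kill [v_j] ([free_triangular]). *)

Set Implicit Arguments.
Unset Strict Implicit.
Unset Printing Implicit Defensive.

Import GRing.Theory.
Local Open Scope ring_scope.

(** * Properties of all but finitely many scalars *)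

Section Generic.

Variable k : fieldType.
Implicit Types (t : k) (P Q : k -> Prop).

(** Exceptional sets are recorded by a polynomial vanishing on them, because
polynomials are what the determinant argument of [generic_free] produces. *)
Definition generic P : Prop :=
  exists2 p : {poly k}, p != 0 & forall t, ~~ root p t -> P t.

Lemma generic_imply P Q : (forall t, P t -> Q t) -> generic P -> generic Q.
Proof. by move=> PQ [p p0 pP]; exists p => // t /pP /PQ. Qed.

Lemma genericT P : (forall t, P t) -> generic P.
Proof. by move=> allP; exists 1; rewrite ?oner_eq0. Qed.

Lemma generic_and P Q : generic P -> generic Q -> generic (fun t => P t /\ Q t).
Proof.
move=> [p p0 pP] [q q0 qQ]; exists (p * q); first by rewrite mulf_neq0.
by move=> t; rewrite rootM negb_or => /andP[/pP Pt /qQ Qt].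
Qed.

Lemma generic_all (T : eqType) (s : seq T) (P : T -> k -> Prop) :
  (forall x, x \in s -> generic (P x)) ->
  generic (fun t => forall x, x \in s -> P x t).
Proof.
elim: s => [|x s IHs] gP; first exact: genericT.
apply: generic_imply (generic_and (gP x (mem_head x s)) (IHs _)).
  by move=> t [Px Ps] y; rewrite inE => /predU1P[->|/Ps].
by move=> y ys; apply: gP; rewrite inE ys orbT.
Qed.

Lemma generic_neq0 : generic (fun t => t != 0).
Proof. by exists 'X; rewrite ?polyX_eq0 // => t; rewrite rootE hornerX. Qed.

Lemma generic_exists P : [pchar k] =i pred0 -> generic P -> exists t, P t.
Proof.
move=> /pcharf0P char0 [p p0 pP].
pose s : seq k := [seq n%:R | n <- iota 0 (size p)].
have natr_inj (m n : nat) : (m <= n)%N -> m%:R = n%:R :> k -> m = n.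
  move=> le_mn eq_mn; apply/eqP; rewrite eqn_leq le_mn /= -subn_eq0 -char0.
  by rewrite natrB // eq_mn subrr.
have s_uniq : uniq s.
  rewrite map_inj_uniq ?iota_uniq // => m n eq_mn.
  case/orP: (leq_total m n) => /natr_inj; first exact.
  by move/(_ (esym eq_mn))/esym.
have /allPn[t _ ptn0] : ~~ all (root p) s.
  apply/negP => sp; have := max_poly_roots p0 sp s_uniq.
  by rewrite size_map size_iota ltnn.
by exists t; apply: pP.
Qed.

(** In coordinates dual to the first components, the family on the line
[t |-> x + t y] has matrix [1 + t C], whose determinant is a polynomial in [t]
with value 1 at 0. *)
Lemma generic_free (V : vectType k) (s : seq (V * V)) :
  free [seq x.1 | x <- s] ->
  generic (fun t => free [seq x.1 + t *: x.2 | x <- s]).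
Proof.
move=> free_s; pose n := size s; pose X := map_tuple fst (in_tuple s).
have XE (i : 'I_n) : X`_i = (s`_i).1 by rewrite /= (nth_map 0).
pose C := \matrix_(i < n, j < n) coord X j (s`_i).2.
pose p := \det (1%:M + 'X *: map_mx polyC C).
have pE t : p.[t] = \det (1%:M + t *: C).
  rewrite -horner_evalE /p -det_map_mx; congr (\det _); apply/matrixP => i j.
  rewrite !mxE /= /horner_eval hornerD hornerM hornerX hornerC.
  by rewrite hornerMn hornerC.
exists p => [|t].
  apply/eqP => p0; have /eqP := pE 0.
  by rewrite p0 scale0r addr0 det1 horner0 eq_sym oner_eq0.
rewrite rootE pE => det_neq0.
apply/(@freeP _ _ _ (map_tuple (fun x => x.1 + t *: x.2) (in_tuple s))) => c c0.
have : \row_i c i *m (1%:M + t *: C) = 0.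
  apply/rowP => j; rewrite !mxE.
  have := congr1 (coord X j) c0; rewrite linear0 linear_sum /= => cj.
  rewrite -[RHS]cj; apply: eq_bigr => i _.
  by rewrite !mxE (nth_map 0) // linearZ linearD linearZ /= -XE coord_free.
move/(congr1 (mulmx^~ (invmx (1%:M + t *: C)))).
rewrite mul0mx mulmxK ?unitmxE ?unitfE // => /rowP row0 i.
by have := row0 i; rewrite !mxE.
Qed.

End Generic.

(** * Vectors absorbing a space of operators *)

Section Absorbing.

Variables (k : fieldType) (V : vectType k).
Hypothesis char0 : [pchar k] =i pred0.
Implicit Types (f g : 'End(V)) (v w : V) (M N : {vspace 'End(V)}).

Lemma generic_apply_neq0 f v w :
  f v != 0 -> generic (fun t => f (v + t *: w) != 0).
Proof.
move=> fv; have := @generic_free k V [:: (f v, f w)].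
rewrite /= seq1_free => /(_ fv); apply: generic_imply => t.
by rewrite seq1_free linearD linearZ.
Qed.

(** If [v] works for all operators but [f], and [f w != 0], then a general
point of the line through [v] in the direction [w] works for all of them. *)
Lemma exists_apply_neq0 (fs : seq 'End(V)) :
  (forall f, f \in fs -> f != 0) -> exists v, forall f, f \in fs -> f v != 0.
Proof.
elim: fs => [|f fs IHfs] fs0; first by exists 0.
have [|v vfs] := IHfs; first by move=> g gfs; apply: fs0; rewrite inE gfs orbT.
have [fv0|fv] := eqVneq (f v) 0; last first.
  by exists v => g; rewrite inE => /predU1P[->|/vfs].
have /lfunPn[w] : f != 0 by apply: fs0; apply: mem_head.
rewrite zero_lfunE => fw.
have [|t [t0 vt]] := @generic_exists k _ char0 (generic_and (generic_neq0 k)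
  (@generic_all k _ fs (fun g t => g (v + t *: w) != 0) _)).
  by move=> g /vfs; apply: generic_apply_neq0.
exists (v + t *: w) => g; rewrite inE => /predU1P[->|/vt //].
by rewrite linearD linearZ /= fv0 add0r scaler_eq0 negb_or t0.
Qed.

(** This is condition (3) for the first vector: the operators that will be left
for the later summands are those of [N] killing [v]. *)
Definition absorbing N v : bool :=
  (ops_image (N :&: lker (eval_at v)) <= eval_at v @: N)%VS.

Lemma mem_lker_eval f v : (f \in lker (eval_at v)) = (f v == 0).
Proof. by rewrite memv_ker eval_atE. Qed.

Lemma mem_limg_eval N f v : f \in N -> f v \in (eval_at v @: N)%VS.
Proof. by move=> fN; rewrite -eval_atE memv_img. Qed.

Lemma not_absorbing N v :
  ~~ absorbing N v ->
  exists f w, [/\ f \in N, f v = 0 & f w \notin (eval_at v @: N)%VS].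
Proof.
case/subvPn => x /ops_imageP[X X_im xX] xN.
have /allPn[y yX yN] : ~~ all (mem (eval_at v @: N)%VS) X.
  by apply: contra xN => /allP/span_subvP/subvP; apply.
have [f [w [fK def_y]]] := X_im y yX; exists f, w; rewrite -def_y.
by move: fK; rewrite memv_cap mem_lker_eval => /andP[fN /eqP fv0].
Qed.

(** The vectors [g v], for [g] in a basis of a complement of the operators of
[N] killing [v], form together with [f w] a free family; moving
along the line, the [g (v + t w)] and [f w] stay independent, and for [t != 0]
they all lie in the image of [N] under evaluation at [v + t w], because
[f (v + t w) = t (f w)]. *)
Lemma rank_increase N v f w :
    f \in N -> f v = 0 -> f w \notin (eval_at v @: N)%VS ->
  generic (fun t =>
    (\dim (eval_at v @: N) < \dim (eval_at (v + t *: w) @: N))%N).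
Proof.
move=> fN fv0 fw; set U := (N :\: lker (eval_at v))%VS.
have sUN : (U <= N)%VS by apply: diffvSl.
have basX : basis_of (eval_at v @: N) [seq eval_at v g | g <- vbasis U].
  by rewrite -limg_ker_compl limg_basis_of ?capv_diff ?vbasisP.
pose s : seq (V * V) := (f w, 0) :: [seq (g v, g w) | g : 'End(V) <- vbasis U].
have [|p p0 pP] := @generic_free k V s.
  have -> : [seq x.1 | x <- s] = f w :: [seq eval_at v g | g <- vbasis U].
    rewrite /= -map_comp; congr (_ :: _).
    by apply: eq_map => g /=; rewrite eval_atE.
  by rewrite free_cons (span_basis basX) fw (basis_free basX).
apply: generic_imply (generic_and (generic_neq0 k) (ex_intro2 _ _ p p0 pP)).
move=> t [t0] free_t.
have line (g : 'End(V)) : g v + t *: g w = g (v + t *: w).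
  by rewrite linearD linearZ.
have /dimvS : (<<[seq (x.1 + t *: x.2)%R | x <- s]>> <=
    eval_at (v + t *: w) @: N)%VS.
  apply/span_subvP => _ /mapP[x + ->]; rewrite inE => /predU1P[->|].
    rewrite /= scaler0 addr0 -[f w]scale1r -(mulVf t0) -scalerA memvZ //.
    by rewrite -[t *: f w]add0r -fv0 line mem_limg_eval.
  case/mapP => g /vbasis_mem/(subvP sUN) gN -> /=.
  by rewrite line mem_limg_eval.
apply: leq_trans; rewrite (eqnP free_t) !size_map /= size_map.
by rewrite size_tuple -limg_ker_compl limg_dim_eq // capv_diff.
Qed.

Lemma exists_absorbing N (fs : seq 'End(V)) :
  (forall f, f \in fs -> f != 0) ->
  exists2 v, absorbing N v & forall f, f \in fs -> f v != 0.
Proof.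
move=> /exists_apply_neq0[v vfs].
(* The rank of the evaluation is bounded by the dimension of V. *)
have [m] := ubnP (\dim {:V} - \dim (eval_at v @: N)).
elim: m v vfs => // m IHm v vfs le_m.
have [|/not_absorbing[f [w [fN fv0 fw]]]] := boolP (absorbing N v).
  by exists v.
have [|t [lt_rank vt]] := generic_exists char0 (generic_and
  (rank_increase fN fv0 fw)
  (@generic_all k _ fs (fun g t => g (v + t *: w) != 0) _)).
  by move=> g /vfs; apply: generic_apply_neq0.
apply: IHm vt _; rewrite -ltnS; apply: leq_trans le_m.
by rewrite ltnS ltn_sub2l // (leq_trans lt_rank) // dimvS // subvf.
Qed.

End Absorbing.

(** * Triangular decompositions *)

Section Triangular.

Variables (k : fieldType) (V : vectType k).
Implicit Types (f g : 'End(V)) (M N : {vspace 'End(V)}).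

(** Applying [g j] to a linear relation kills the terms before [v_j]; by
downward induction on [j] those after it are zero, so the coefficient of [v_j]
vanishes. *)
Lemma free_triangular s (v : s.-tuple V) (g : 'I_s -> 'End(V)) :
    (forall i j : 'I_s, (i < j)%N -> g j (tnth v i) = 0) ->
    (forall j, g j (tnth v j) != 0) ->
  free v.
Proof.
move=> g_lt g_diag; apply/freeP => c c0 j.
have [m] := ubnP (s - j); elim: m j => // m IHm j le_m.
have := congr1 (g j) c0; rewrite linear0 linear_sum (bigD1 j) //= big1 => [|i].
  rewrite addr0 linearZ /= -tnth_nth => /eqP.
  by rewrite scaler_eq0 (negPf (g_diag j)) orbF => /eqP.
rewrite neq_ltn linearZ /= -tnth_nth => /orP[/g_lt->|lt_ji].
  by rewrite scaler0.
rewrite IHm ?scale0r // -ltnS; apply: leq_trans le_m.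
by rewrite ltnS ltn_sub2l // ltn_ord.
Qed.

Lemma lker_eval_inj M v :
  (M :&: lker (eval_at v) = 0)%VS -> {in M &, injective (eval_at v)}.
Proof.
move=> MK0 f g fM gM /eqP; rewrite -subr_eq0 -linearB -memv_ker => fgK.
apply/eqP; rewrite -subr_eq0 -memv0 -MK0 memv_cap fgK andbT.
exact: memvB.
Qed.

(** Everything an adapted decomposition asks for except the independence of the
vectors, which follows by [free_triangular]; without it the conditions
can be verified one vector at a time. *)
Definition triangular N (s : nat) (v : s.-tuple V)
    (N_ : 'I_s -> {vspace 'End(V)}) : Prop :=
  [/\ [/\ N = (\sum_(i < s) N_ i)%VS, directv (\sum_(i < s) N_ i)
        & forall i, N_ i != 0%VS],
      forall i, (N_ i :&: lker (eval_at (tnth v i)) = 0)%VS,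
      forall i j : 'I_s, (i < j)%N -> (N_ j <= lker (eval_at (tnth v i)))%VS
    & forall i j : 'I_s, (i < j)%N ->
        (ops_image (N_ j) <= eval_at (tnth v i) @: N_ i)%VS].

Lemma triangular_adapted N s (v : s.-tuple V) (N_ : 'I_s -> {vspace 'End(V)}) :
  triangular N v N_ -> adapted_decomposition N v N_.
Proof.
move=> [[defN dirN N_n0] injF kerF imF]; split=> //.
- split=> //.
  apply: (@free_triangular _ v (fun j => vpick (N_ j))) => [i j ij|j].
    by apply/eqP; rewrite -mem_lker_eval (subvP (kerF i j ij)) ?memv_pick.
  apply: contra (N_n0 j) => gj0; rewrite -vpick0 -memv0 -(injF j) memv_cap.
  by rewrite memv_pick mem_lker_eval.
- by move=> i; apply: lker_eval_inj.
- by move=> i j ij; rewrite subv_cap kerF // defN (sumv_sup j).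
Qed.

Lemma ops_imageS M N : (M <= N)%VS -> (ops_image M <= ops_image N)%VS.
Proof.
move=> /subvP sMN; apply/subvP => x /ops_imageP[X X_im xX].
apply/ops_imageP; exists X => // y /X_im[f [w [/sMN fN ->]]].
by exists f, w.
Qed.

(** With [K] the kernel of evaluation at [v0], the complement [N :\: K] of
[N :&: K] in [N] has the same image as [N] under this evaluation, so absorption
gives condition (3) for the new first index, while condition (2) there holds
since the other summands lie in [K]. *)
Lemma triangular_cons N v0 s (v : s.-tuple V) (N_ : 'I_s -> {vspace 'End(V)}) :
    absorbing N v0 -> ~~ (N <= lker (eval_at v0))%VS ->
    triangular (N :&: lker (eval_at v0)) v N_ ->
  triangular N [tuple of v0 :: v]
    (fun i => if unlift ord0 i is Some j then N_ j
              else (N :\: lker (eval_at v0))%VS).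
Proof.
set K := lker _ => abs0 N_K [[defK dirK N_n0] injF kerF imF].
set M_ : 'I_s.+1 -> {vspace 'End(V)} := fun i => if _ is Some j then _ else _.
have M0 : M_ ord0 = (N :\: K)%VS by rewrite /M_ unlift_none.
have ML j : M_ (lift ord0 j) = N_ j by rewrite /M_ liftK.
have N_sub j : (N_ j <= N :&: K)%VS by rewrite defK (sumv_sup j).
have sumM : (\sum_(i < s.+1) M_ i = N :\: K + \sum_(j < s) N_ j)%VS.
  by rewrite big_ord_recl M0; congr (_ + _)%VS; apply: eq_bigr => j _.
have allP (P : 'I_s.+1 -> Prop) :
    P ord0 -> (forall j, P (lift ord0 j)) -> forall i, P i.
  by move=> P0 PL i; case: (unliftP ord0 i) => [j|] ->.
split; [split | | |].
- by rewrite sumM -defK addv_diff_cap.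
- have capK0 : ((N :\: K) :&: \sum_(j < s) N_ j = 0)%VS.
    by rewrite -defK capvA (capv_idPl (diffvSl _ _)) capv_diff.
  rewrite directvE /= sumM dimv_disjoint_sum // (eqnP dirK) big_ord_recl M0 /=.
  by rewrite eqn_add2l; apply/eqP/eq_bigr => j _; rewrite ML.
- elim/allP => [|j]; rewrite ?ML // M0.
  by apply: contra N_K => /eqP D0; rewrite -diffv_eq0 D0.
- elim/allP => [|j]; rewrite ?M0 ?capv_diff // ML.
  by rewrite tnthS.
- elim/allP => [|i]; elim/allP => [|j] //; rewrite !ML.
    by move=> _; apply: subv_trans (N_sub j) (capvSr _ _).
  by rewrite ltnS => /kerF; rewrite tnthS.
- elim/allP => [|i]; elim/allP => [|j] //; rewrite !ML ?M0.
    move=> _; rewrite limg_ker_compl.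
    exact: subv_trans (ops_imageS (N_sub j)) abs0.
  by rewrite ltnS => /imF; rewrite tnthS.
Qed.

(** Prescribing in addition a nonzero operator of [N] ensures that the first
vector is not killed by all of [N], so that the dimension drops. *)
Lemma exists_first_vector N (fs : seq 'End(V)) :
    [pchar k] =i pred0 -> N != 0%VS -> (forall f, f \in fs -> f != 0) ->
  exists v0, [/\ absorbing N v0, ~~ (N <= lker (eval_at v0))%VS
               & forall f, f \in fs -> f v0 != 0].
Proof.
move=> char0 N_n0 fs_n0.
have [|v0 abs0 v0fs] := exists_absorbing char0 N (fs := vpick N :: fs).
  by move=> f; rewrite inE => /predU1P[->|/fs_n0]; rewrite ?vpick0.
exists v0; split=> // [|f ffs]; last by apply: v0fs; rewrite inE ffs orbT.
apply/subvPn; exists (vpick N); first exact: memv_pick.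
by rewrite mem_lker_eval v0fs ?mem_head.
Qed.

(** Induction on [\dim N]: the operators killing the first vector form a proper
subspace, and the zero space has the empty decomposition. *)
Lemma exists_triangular N : [pchar k] =i pred0 ->
  exists (s : nat) (v : s.-tuple V) (N_ : 'I_s -> {vspace 'End(V)}),
    triangular N v N_.
Proof.
move=> char0; have [m] := ubnP (\dim N); elim: m N => // m IHm N le_m.
have [->|N_n0] := eqVneq N 0%VS.
  exists 0, [tuple], (fun=> 0%VS); split=> [||[]|[]] //; last by case.
  by split=> [||[]] //; rewrite ?directvE /= !big_ord0 ?dimv0.
have [|v0 [abs0 N_K _]] := exists_first_vector (fs := [::]) char0 N_n0.
  by [].
have [|s [v [N_ vK]]] := IHm (N :&: lker (eval_at v0))%VS.
  rewrite -ltnS; apply: leq_trans le_m.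
  rewrite ltnS ltn_neqAle dimvS ?capvSl // andbT.
  by rewrite (dimv_leqif_eq (capvSl _ _)) (sameP eqP capv_idPl).
by eexists _, _, _; apply: triangular_cons abs0 N_K vK.
Qed.

End Triangular.

Theorem theorem4p4 (k : fieldType) (char0 : [pchar k] =i pred0)
    (V : vectType k) (N : {vspace 'End(V)})
    (N_neq0 : N != 0%VS)
    (N_abelian : abelian_ops N)
    (N_nilpotent : forall f : 'End(V), f \in N -> nilpotent_op f) :
  (exists (s : nat) (v : s.-tuple V) (N_ : 'I_s -> {vspace 'End(V)}),
     adapted_decomposition N v N_)
  /\
  (forall Ns : seq 'End(V),
     (forall f : 'End(V), f \in Ns -> f \in N /\ f != 0) ->
     exists (s : nat) (v : s.-tuple V) (N_ : 'I_s -> {vspace 'End(V)}),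
       adapted_decomposition N v N_
       /\ (forall f : 'End(V), f \in Ns -> f v`_0 != 0)).
Proof.
suff adapted (Ns : seq 'End(V)) :
    (forall f : 'End(V), f \in Ns -> f \in N /\ f != 0) ->
    exists (s : nat) (v : s.-tuple V) (N_ : 'I_s -> {vspace 'End(V)}),
      adapted_decomposition N v N_ /\ (forall f, f \in Ns -> f v`_0 != 0).
  split=> [|Ns]; last exact: adapted.
  by have [//|s [v [N_ [vN _]]]] := adapted [::]; exists s, v, N_.
move=> NsN.
have [|v0 [abs0 N_K v0_Ns]] :=
    exists_first_vector (fs := Ns) char0 N_neq0.
  by move=> f /NsN[].
have [s [v [N_ vK]]] := exists_triangular (N :&: lker (eval_at v0))%VS char0.
by do 3 eexists; split; first exact/triangular_adapted/triangular_cons/vK.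
Qed.
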